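(* Let $C$ be a circle graph, $r\ge1$ an integer, and $S$ an independent $r$-incident multiset of vertices of $C$. Then there exists an independent set $A\subseteq V(C)$ such that $C\star^r S = C\star^1 A$; in particular $C\star^r S$ is a circle graph. Equivalently, in terms of graph states: if $C$ is a circle graph and $G$ is a graph such that $|G\rangle$ is LU-equivalent to $|C\rangle$, then $|G\rangle$ is LC-equivalent to $|C\rangle$ and $G$ is a circle graph.
   Context: Graphs are finite, simple, undirected; $N_G(u)$ is the neighbourhood of $u$. A circle graph is a graph isomorphic to the intersection graph of a finite set of chords of a circle. A multiset $S$ of vertices is identified with its multiplicity function $S:V(G)\to\mathbb N$, with support $\mathrm{supp}(S)=\{u:S(u)\ge1\}$; it is independent if its support contains no two adjacent vertices. For $r\ge1$, $S$ is $r$-incident if for every $k\in\{0,\dots,r-1\}$ and every $K\subseteq V(G)\setminus\mathrm{supp}(S)$ with $|K|=k+2$, $\sum_{u\in\bigcap_{v\in K}N_G(v)}S(u)$ is a multiple of $2^{r-k-\delta(k)}$ ($\delta(0)=1$, $\delta(k)=0$ for $k\neq0$). For independent $r$-incident $S$, $G\star^r S$ is the graph on $V(G)$ where distinct $a,b$ are adjacent iff exactly one of: $a\sim_G b$; $\sum_{u\in N_G(a)\cap N_G(b)}S(u)\equiv 2^{r-1}\pmod{2^r}$. For an independent set $A=\{u_1,\dots,u_k\}$, $G\star^1 A=G\star u_1\star\cdots\star u_k$ where $G\star u$ complements the subgraph induced on $N_G(u)$. The graph state of a graph $G$ on $n$ vertices is $|G\rangle=\prod_{\{u,v\}\in E(G)}CZ_{uv}\,|+\rangle^{\otimes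 V(G)}$, with $|+\rangle=(|0\rangle+|1\rangle)/\sqrt2$ and $CZ|x_1x_2\rangle=(-1)^{x_1x_2}|x_1x_2\rangle$. Two states are LU-equivalent if one is obtained from the other by a tensor product of single-qubit unitaries, and LC-equivalent if this can be done, up to global phase, with a tensor product of single-qubit Clifford unitaries (unitaries normalizing the single-qubit Pauli group). Known fact (used for the equivalence): two graph states $|G\rangle,|G'\rangle$ are LU-equivalent iff $G'$ is obtained from $G$ by a sequence of valid $r$-local complementations (for various $r$), and LC-equivalent iff $G'$ is obtained from $G$ by a sequence of local complementations. *)

(* Defs.v *)
From mathcomp Require Import all_boot.
Set Implicit Arguments. Unset Strict Implicit. Unset Printing Implicit Defensive.

Section Graphs.
Variable T : finType.

Definition simple_graph (e : rel T) : Prop := symmetric e /\ irreflexive e.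

Definition nbhd (e : rel T) (u : T) : {set T} := [set v | e u v].

(* Chords of a circle: the circle is cut at a point that is not an endpoint,
   so a chord is a pair of positions (a,b) with a < b on a line (nat).
   Two chords (closed segments) intersect iff they share an endpoint or
   their endpoints interleave. *)
Definition chord_ok (c : nat * nat) : bool := c.1 < c.2.
Definition chords_intersect (c d : nat * nat) : bool :=
  [|| c.1 == d.1, c.1 == d.2, c.2 == d.1, c.2 == d.2,
      (c.1 < d.1) && (d.1 < c.2) && (c.2 < d.2)
    | (d.1 < c.1) && (c.1 < d.2) && (d.2 < c.2)].

Definition circle_graph (e : rel T) : Prop :=
  exists f : T -> nat * nat,
    injective f /\ (forall v, chord_ok (f v)) /\
    (forall u v, u != v -> e u v = chords_intersect (f u) (f v)).

(* Multisets of vertices: multiplicity functions S : T -> nat. *)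
Definition supp (S : T -> nat) : {set T} := [set u | 0 < S u].

Definition independent_ms (e : rel T) (S : T -> nat) : Prop :=
  forall u v, u \in supp S -> v \in supp S -> ~~ e u v.

Definition independent_set (e : rel T) (A : {set T}) : Prop :=
  forall u v, u \in A -> v \in A -> ~~ e u v.

Definition delta (k : nat) : nat := if k == 0 then 1 else 0.

Definition common_sum (e : rel T) (S : T -> nat) (K : {set T}) : nat :=
  \sum_(u in \bigcap_(v in K) nbhd e v) S u.

Definition r_incident (e : rel T) (r : nat) (S : T -> nat) : Prop :=
  forall k, k < r ->
  forall K : {set T}, K \subset ~: supp S -> #|K| = k.+2 ->
    2 ^ (r - k - delta k) %| common_sum e S K.

Definition star_r (e : rel T) (r : nat) (S : T -> nat) : rel T :=
  fun a b => (a != b) &&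
    (e a b (+) (common_sum e S [set a; b] %% 2 ^ r == 2 ^ r.-1)).

Definition local_comp (e : rel T) (u : T) : rel T :=
  fun a b => (a != b) && (e a b (+) (e u a && e u b)).

Definition star_1 (e : rel T) (A : {set T}) : rel T :=
  foldl local_comp e (enum A).

End Graphs.

(* Main.v *)
Require Import Defs.
From mathcomp Require Import all_boot zify.
Set Implicit Arguments. Unset Strict Implicit. Unset Printing Implicit Defensive.

(* The chords of [supp S] do not cross, and a chord [a] meets them in a linear
   order in which those met by a second chord form an interval. Hence a
   common neighbourhood in [supp S] of at least two vertices is already one of
   two or three vertices, and the cases k = 0, 1 of r-incidence make the total
   multiplicity of every such common neighbourhood divisible by 2^(r-1). By
   Moebius inversion the same holds for every class of twins, i.e. of vertices
   with one neighbourhood B, |B| >= 2. For A, take one vertex of [supp S] from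
   each class whose multiplicity is an odd multiple of 2^(r-1). *)

(* When the four points are distinct, [crossb x y z w] says that [x, y]
   separate [z, w]; the ends of a chord need not be ordered. *)
Definition sideb (x y z : nat) : bool := (x < z) (+) (y < z).
Definition crossb (x y z w : nat) : bool := sideb x y z (+) sideb x y w.

Lemma crossb_swapl x y z w : crossb y x z w = crossb x y z w.
Proof. by rewrite /crossb /sideb; do 4!case: (_ < _). Qed.

Lemma crossb_swapr x y z w : crossb x y w z = crossb x y z w.
Proof. by rewrite /crossb addbC. Qed.

Lemma crossb_chords x y z w : x < y -> z < w ->
  x != z -> x != w -> y != z -> y != w ->
  crossb x y z w = chords_intersect (x, y) (z, w).
Proof.
rewrite /crossb /sideb /chords_intersect /=.
lia.
Qed.

(** The chord [yY] cuts the disc into two parts, with [xX] in one and [b1 b2] in the other. *)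
Lemma crossb_one_side x y X Y b1 b2 : x != y -> X != y -> x != Y -> X != Y ->
  b1 != x -> b1 != X -> b2 != x -> b2 != X -> b1 != y -> b2 != y -> b1 != Y -> b2 != Y ->
  sideb y Y x = sideb y Y X -> sideb y Y b1 = sideb y Y b2 ->
  sideb y Y x != sideb y Y b1 -> crossb x X b1 b2 = false.
Proof.
rewrite /crossb /sideb.
lia.
Qed.

(* The chord [yY] separates [xX] from [zZ], and a chord crossing both has to cross it. *)
Lemma crossb_between a1 a2 x X y Y z Z b1 b2 :
  sideb a1 a2 x -> sideb a1 a2 z -> ~~ sideb a1 a2 Y -> x < y < z ->
  [&& X != y, X != Y, x != b1, x != b2, X != b1 & X != b2] ->
  [&& Z != y, Z != Y, z != b1, z != b2, Z != b1 & Z != b2] ->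
  [&& y != b1, y != b2, Y != b1 & Y != b2] ->
  ~~ crossb y Y x X -> ~~ crossb y Y z Z ->
  crossb x X b1 b2 -> crossb z Z b1 b2 -> crossb y Y b1 b2.
Proof.
move=> ax az aY /andP[xy yz] dx dz dy.
(* [x] and [z] lie between [a1] and [a2] while [Y] does not, so [Y] is not between [x] and [z],
   whereas [y] is. *)
have sx_z : sideb y Y x != sideb y Y z.
  have -> : sideb y Y x = (Y < x) by rewrite /sideb ltnNge (ltnW xy).
  have -> : sideb y Y z = ~~ (Y < z) by rewrite /sideb yz.
  by move: ax az aY; rewrite /sideb; clear -x; lia.
(* If [b1 b2] misses [yY], a chord [uU] crossing [b1 b2] but not [yY] lies on the side of [b1]. For
   [xX] and [zZ] together this contradicts [sx_z]. *)
have aux u U : [&& U != y, U != Y, u != b1, u != b2, U != b1 & U != b2] ->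
    u != y -> u != Y -> ~~ crossb y Y u U -> crossb u U b1 b2 ->
    ~~ crossb y Y b1 b2 -> sideb y Y u = sideb y Y b1.
  case/and5P=> Uy UY ub1 ub2 /andP[Ub1 Ub2] uy uY yu ub yb.
  case/and4P: dy => yb1 yb2 Yb1 Yb2.
  apply: contraTeq ub => nb; rewrite (@crossb_one_side u y U Y) // 1?eq_sym //.
  - by move: yu; rewrite negb_add => /eqP.
  - by move: yb; rewrite negb_add => /eqP.
have xY : x != Y by apply: contraNneq aY => <-.
have zY : z != Y by apply: contraNneq aY => <-.
move=> yx yz' xb zb; apply: contraNT sx_z => yb.
have neq_xy : x != y by rewrite ltn_eqF.
have neq_zy : z != y by rewrite gtn_eqF.
by rewrite (aux x X) ?(aux z Z).
Qed.

(** * Reversal of a segment of the line *)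

Definition reflect_in (l r x : nat) : nat := if l <= x <= r then l + r - x else x.

Lemma reflect_in_inj l r : injective (reflect_in l r).
Proof. by move=> x y; rewrite /reflect_in; do 2!case: ifP; lia. Qed.

Lemma ltn_reflect_in l r x z : x != z ->
  (reflect_in l r x < reflect_in l r z) = (x < z) (+) ((l <= x <= r) && (l <= z <= r)).
Proof. by rewrite /reflect_in; do 2!case: ifP; lia. Qed.

Section CircleGraphs.
Variable T : finType.
Implicit Types (e : rel T) (S : T -> nat) (u v a b : T) (A B K : {set T}).

(** * Chord models and their change under local complementation *)

Definition distinct_ends (p q : T -> nat) : Prop :=
  [/\ injective p, injective q & forall u v, p u != q v].

(** The ends [p u] and [q u] come in either order, so that the reversal of a segment can act on each
    end separately. *)
Definition crossing_model e (p q : T -> nat) : Prop :=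
  distinct_ends p q /\
  forall u v, u != v -> e u v = crossb (p u) (q u) (p v) (q v).

Lemma circle_graph_model e : circle_graph e -> exists p q, crossing_model e p q.
Proof.
case=> f [injf [okf ef]].
pose M := (\max_u (maxn (f u).1 (f u).2)).+1.
have ltM u : ((f u).1 < M) /\ ((f u).2 < M).
  have := leq_bigmax (F := fun u => maxn (f u).1 (f u).2) u.
  rewrite /M; lia.
(* Shared endpoints are split so that all chords meeting there still cross:
   beginning chords come first, and each kind is sorted by the other end. *)
pose lexi x y := x * (2 * M) + y.
have lexi_lt x y z w : y < 2 * M -> w < 2 * M ->
    (lexi x y < lexi z w) = (x < z) || ((x == z) && (y < w)).
  rewrite /lexi => hy hw; case: (ltngtP x z) => /= [xz|zx|->].
  - nia.
  - nia.
  - by rewrite ltn_add2l.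
have lexi_eq x y z w : y < 2 * M -> w < 2 * M ->
    (lexi x y == lexi z w) = (x == z) && (y == w).
  rewrite /lexi => hy hw; case: (ltngtP x z) => /= [xz|zx|->].
  - nia.
  - nia.
  - by rewrite eqn_add2l.
(* The offset [M] puts closing ends after opening ones at the same point; second keys stay below
   [2 * M], as [lexi_lt] requires. *)
exists (fun u => lexi (f u).1 (f u).2), (fun u => lexi (f u).2 (M + (f u).1)).
have f_eq u v : (f u).1 = (f v).1 -> (f u).2 = (f v).2 -> u = v.
  move=> h1 h2; apply: injf; case: (f u) (f v) h1 h2 => [? ?] [? ?] /=.
  by move=> -> ->.
split; first split.
- move=> u v /eqP; case: (ltM u) (ltM v) => [? ?] [? ?].
  by rewrite lexi_eq; [move=> /andP[/eqP ? /eqP ?]; exact: f_eq| lia | lia].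
- move=> u v /eqP; case: (ltM u) (ltM v) => [? ?] [? ?].
  rewrite lexi_eq; [move=> /andP[/eqP ? /eqP ?]; apply: f_eq; lia | lia | lia].
- move=> u v; case: (ltM u) (ltM v) => [? ?] [? ?].
  by rewrite lexi_eq; lia.
move=> u v neq_uv; rewrite ef //.
case: (ltM u) (ltM v) (okf u) (okf v) => [u1 u2] [v1 v2].
rewrite /chord_ok /crossb /sideb !lexi_lt; [|lia ..].
have : ((f u).1 != (f v).1) || ((f u).2 != (f v).2).
  rewrite -negb_and; apply: contra neq_uv => /andP[/eqP ? /eqP ?].
  by apply/eqP/f_eq.
rewrite /chords_intersect.
move: (f u) (f v) u1 u2 v1 v2 {lexi_lt lexi_eq ltM lexi f_eq} => [a b] [c d] /=.
move: M => M {injf okf ef}.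
case: (ltngtP a c) => /= *; case: (ltngtP b d) => /= *; lia.
Qed.

Lemma crossing_model_circle_graph e p q :
  crossing_model e p q -> circle_graph e.
Proof.
case=> [[injp injq npq] epq].
pose f u := if p u < q u then (p u, q u) else (q u, p u).
exists f; split; last split.
- move=> u v; rewrite /f.
  by do 2!case: ifP => _; case=> h1 h2; first [exact: injp | exact: injq
    | by move: (npq u v) (npq v u); rewrite ?h1 ?h2 eqxx].
- by move=> u; rewrite /f /chord_ok; have := npq u u; case: ifP => /=; lia.
move=> u v neq_uv; rewrite epq //.
have nuv := npq u v; have nvu := npq v u.
have nuu := npq u u; have nvv := npq v v.
have pp : p u != p v by apply: contra neq_uv => /eqP /injp ->.
have qq : q u != q v by apply: contra neq_uv => /eqP /injq ->.
rewrite /f; case: ifP => hu; case: ifP => hv; rewrite -crossb_chords //; try lia.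
- by rewrite crossb_swapr.
- by rewrite crossb_swapl.
- by rewrite crossb_swapl crossb_swapr.
Qed.

Lemma eq_circle_graph e e' : (forall a b, e a b = e' a b) ->
  circle_graph e -> circle_graph e'.
Proof.
move=> ee [f [injf [okf ef]]]; exists f; split=> //; split=> // u v neq.
by rewrite -ee ef.
Qed.

(* Complementing at [u] reverses the part of the circle between the ends of [u]. *)
Lemma local_comp_circle_graph e u : simple_graph e ->
  circle_graph e -> circle_graph (local_comp e u).
Proof.
case=> sym_e irr_e /circle_graph_model[p [q [[injp injq npq] epq]]].
pose l := minn (p u) (q u); pose r := maxn (p u) (q u).
pose inside x := l <= x <= r.
have eu v : v != u -> e u v = inside (p v) (+) inside (q v).
  move=> neq; rewrite epq; last by rewrite eq_sym.
  have h1 := npq v u; have h2 := npq u v; have h0 := npq u u.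
  have h3 : p v != p u by apply: contra neq => /eqP /injp ->.
  have h4 : q v != q u by apply: contra neq => /eqP /injq ->.
  by rewrite /crossb /sideb /inside /l /r; lia.
have uu : inside (p u) (+) inside (q u) = false.
  by rewrite /inside /l /r; lia.
have eu' v : e u v = inside (p v) (+) inside (q v).
  by case: (eqVneq v u) => [->|/eu //]; rewrite irr_e uu.
apply: (@crossing_model_circle_graph _ (reflect_in l r \o p) (reflect_in l r \o q)).
split; first split.
- exact: inj_comp (@reflect_in_inj l r) injp.
- exact: inj_comp (@reflect_in_inj l r) injq.
- by move=> v w; rewrite (inj_eq (@reflect_in_inj l r)).
move=> a b neq; rewrite /local_comp neq /= epq // !eu'.
have pp : p a != p b by apply: contra neq => /eqP /injp ->.
have qq : q a != q b by apply: contra neq => /eqP /injq ->.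
have qp : q a != p b by rewrite eq_sym.
(* Each of the four comparisons flips by a product of two [inside] values. These products sum modulo
   2 to the product of the adjacencies of [a] and [b] to [u]. *)
rewrite /crossb /sideb !ltn_reflect_in // -/(inside (p a)) -/(inside (p b)) -/(inside (q a)) -/(inside (q b)).
case: (inside _); case: (inside _); case: (inside _); case: (inside _);
case: (_ < _); case: (_ < _); case: (_ < _); by case: (_ < _).
Qed.

(** * Sequences of local complementations *)

Lemma local_comp_simple e u : simple_graph e -> simple_graph (local_comp e u).
Proof.
case=> sym_e irr_e; split=> [a b|a]; rewrite /local_comp.
  by rewrite eq_sym sym_e; congr (_ && (_ (+) _)); rewrite andbC.
by rewrite eqxx.
Qed.

Lemma foldl_local_comp_circle_graph e (s : seq T) : simple_graph e ->
  circle_graph e -> circle_graph (foldl (@local_comp T) e s).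
Proof.
elim: s e => //= u s IHs e se ce; apply: IHs; first exact: local_comp_simple.
exact: local_comp_circle_graph.
Qed.

(** Complementing at a vertex of [s] changes no neighbourhood of a vertex of [s], as none is
    adjacent to it. All toggles can therefore be read off the original [e]. *)
Lemma foldl_local_comp e (s : seq T) a b : simple_graph e ->
  (forall u v, u \in s -> v \in s -> ~~ e u v) ->
  foldl (@local_comp T) e s a b =
  (a != b) && (e a b (+) odd (count (fun u => e u a && e u b) s)).
Proof.
elim: s e => /= [|u s IHs] e se ind.
  by rewrite addbF; case: eqP => // <-; case: se => _ ->.
have eqe v c : v \in s -> local_comp e u v c = e v c.
  move=> vs; rewrite /local_comp (negbTE (ind u v _ _)) ?inE ?eqxx ?vs ?orbT //=.
  by rewrite addbF; case: eqP => // <-; case: se => _ ->.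
rewrite IHs; first last.
- by move=> v w vs ws; rewrite eqe // ind // inE ?vs ?ws orbT.
- exact: local_comp_simple.
rewrite /local_comp oddD oddb.
under eq_in_count => v vs do rewrite -!/(local_comp e u v _) !eqe //.
by case: (a != b) => //=; rewrite addbA.
Qed.

Lemma star_1E e A a b : simple_graph e -> independent_set e A ->
  star_1 e A a b =
  (a != b) && (e a b (+) odd #|[set u in A | e u a && e u b]|).
Proof.
move=> se ind; rewrite /star_1 foldl_local_comp //; last first.
  by move=> u v; rewrite !mem_enum; exact: ind.
congr (_ && (_ (+) odd _)).
rewrite -size_filter cardE /enum_mem -filter_predI size_filter size_filter.
by apply: eq_count => u; rewrite /= !inE andbC.
Qed.

(** * Common neighbourhoods among non-crossing chords *)

(** For [x] crossing [a], [inner x] is the end between [p a] and [q a], so [inner] orders such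
    chords along [a]. The middle chord [v] separates [u] from [w], and [crossb_between] applies. *)
Lemma crossing_model_convex e p q a b u v w (inner := fun x =>
    if sideb (p a) (q a) (p x) then p x else q x) :
  simple_graph e -> crossing_model e p q ->
  e a u -> e a v -> e a w -> ~~ e u v -> ~~ e v w ->
  inner u <= inner v <= inner w -> v != b -> e b u -> e b w -> e b v.
Proof.
move=> [sym_e irr_e] [[injp injq npq] epq] au av aw uv vw le_uvw vb bu bw.
have neq x y : e x y -> x != y by apply: contraTneq => ->; rewrite irr_e.
case: (eqVneq u v) => [<- //|neq_uv]; case: (eqVneq w v) => [<- //|neq_wv].
pose outer x := if sideb (p a) (q a) (p x) then q x else p x.
have eio x y : x != y -> e x y = crossb (inner x) (outer x) (p y) (q y).
  by move=> /epq ->; rewrite /inner /outer; case: ifP; rewrite // crossb_swapl.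
have eioio x y : x != y -> e x y = crossb (inner x) (outer x) (inner y) (outer y).
  by move=> /eio ->; rewrite /inner /outer; case: (sideb _ _ (p y)); rewrite // crossb_swapr.
have pp x y : x != y -> p x != p y by apply: contra => /eqP /injp ->.
have qq x y : x != y -> q x != q y by apply: contra => /eqP /injq ->.
have qp x y : q x != p y by rewrite eq_sym.
have dist x y : x != y -> [&& inner x != p y, inner x != q y, outer x != p y & outer x != q y].
  by move=> xy; rewrite /inner /outer; case: ifP; rewrite ?pp ?qq ?npq ?qp.
have distio x y : x != y -> [&& inner x != inner y, inner x != outer y, outer x != inner y & outer x != outer y].
  move=> /dist /and4P[h1 h2 h3 h4]; rewrite /(inner y) /(outer y).
  by case: ifP => _; rewrite h1 h2 h3 h4.
have in_out x : e a x -> sideb (p a) (q a) (inner x) /\ ~~ sideb (p a) (q a) (outer x).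
  move=> ax; move: (ax); rewrite epq ?neq // /crossb /inner /outer.
  by case: ifP => hx; rewrite hx; case: (sideb _ _ (q x)).
have [[[iu _] [iw _]] [_ ov]] := (in_out u au, in_out w aw, in_out v av).
have bu' := neq _ _ bu; have bw' := neq _ _ bw.
rewrite sym_e eio //.
have := distio _ _ neq_uv; have := distio _ _ neq_wv.
rewrite eq_sym in bu'; rewrite eq_sym in bw'.
move=> /and4P[wv1 wv2 wv3 wv4] /and4P[uv1 uv2 uv3 uv4].
case/and4P: (dist _ _ vb) => vb1 vb2 vb3 vb4.
case/and4P: (dist _ _ bu') => ub1 ub2 ub3 ub4.
case/and4P: (dist _ _ bw') => wb1 wb2 wb3 wb4.
apply: (@crossb_between (p a) (q a) (inner u) (outer u) _ _ (inner w) (outer w)) => //.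
- by rewrite !ltn_neqAle uv1 eq_sym wv1.
- by rewrite uv3 uv4 ub1 ub2 ub3 ub4.
- by rewrite wv3 wv4 wb1 wb2 wb3 wb4.
- by rewrite vb1 vb2 vb3 vb4.
- by rewrite -eioio ?[v == u]eq_sym // sym_e.
- by rewrite -eioio // eq_sym.
- by rewrite -eio // sym_e.
- by rewrite -eio // sym_e.
Qed.

(* Along a fixed chord [a] of [B], the vertices of [supp S] that also cross
   [b] form an interval, and finitely many intervals meet in the intersection
   of two of them. *)
Lemma common_nbhd_three e S B : simple_graph e -> circle_graph e ->
  independent_ms e S -> 1 < #|B| ->
  exists K, [/\ K \subset B, 1 < #|K| <= 3 &
    forall u, u \in supp S -> K \subset nbhd e u -> B \subset nbhd e u].
Proof.
move=> se /circle_graph_model[p [q mod_e]] indS /card_gt1P[a [d0 [aB d0B neq_ad0]]].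
have [sym_e irr_e] := se.
pose inner x := if sideb (p a) (q a) (p x) then p x else q x.
pose X b := [set u in supp S | e a u && e b u].
(* [up b] and [dn b] are the upward and downward closures of [X b] in the order along [a]; by
   convexity they meet in [X b] ([updn]). *)
pose up b := [set u in supp S | e a u && [exists v in X b, inner v <= inner u]].
pose dn b := [set u in supp S | e a u && [exists v in X b, inner u <= inner v]].
have Xup b : X b \subset up b.
  apply/subsetP=> u uX; move: (uX); rewrite !inE => /and3P[-> -> _] /=.
  by apply/existsP; exists u; rewrite uX leqnn.
have Xdn b : X b \subset dn b.
  apply/subsetP=> u uX; move: (uX); rewrite !inE => /and3P[-> -> _] /=.
  by apply/existsP; exists u; rewrite uX leqnn.
have updn b u : u \in up b -> u \in dn b -> e b u.
  rewrite !inE => /and3P[uS au /exists_inP[v vX vu]] /and3P[_ _ /exists_inP[w wX uw]].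
  move: vX wX; rewrite !inE => /and3P[vS av bv] /and3P[wS aw bw].
  apply: (@crossing_model_convex e p q a b v u w) => //.
  - by apply: indS; rewrite inE.
  - by apply: indS; rewrite inE.
  - by rewrite -/(inner v) -/(inner u) -/(inner w) vu.
  - by apply: contraTneq bv => <-; apply: indS; rewrite inE.
(* Closures upward in a total preorder form a chain, so cardinality decides inclusion. *)
have up_chain b c : #|up b| <= #|up c| -> up b \subset up c.
  move=> le_bc; apply/subsetP=> u ub; apply: contraLR le_bc => uc; rewrite -ltnNge.
  apply: proper_card; apply/properP; split; last by exists u.
  apply/subsetP=> v vc; move: ub uc vc.
  rewrite !inE => /and3P[-> -> /exists_inP[w wX wu]] /=.
  move=> /exists_inPn uc /and3P[-> -> /exists_inP[x xX xv]] /=.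
  apply/exists_inP; exists w => //.
  by have := uc x xX; rewrite -ltnNge; lia.
have dn_chain b c : #|dn b| <= #|dn c| -> dn b \subset dn c.
  move=> le_bc; apply/subsetP=> u ub; apply: contraLR le_bc => uc; rewrite -ltnNge.
  apply: proper_card; apply/properP; split; last by exists u.
  apply/subsetP=> v vc; move: ub uc vc.
  rewrite !inE => /and3P[-> -> /exists_inP[w wX wu]] /=.
  move=> /exists_inPn uc /and3P[-> -> /exists_inP[x xX xv]] /=.
  apply/exists_inP; exists w => //.
  by have := uc x xX; rewrite -ltnNge; lia.
have d0Ba : d0 \in B :\ a by rewrite !inE eq_sym neq_ad0.
(* The least [up b] and the least [dn c] bound the common interval, so [a], [b], [c] suffice; [b]
   and [c] may coincide. *)
case: (@arg_minnP _ d0 (mem (B :\ a)) (fun b => #|up b|) d0Ba) => b bBa min_b.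
case: (@arg_minnP _ d0 (mem (B :\ a)) (fun b => #|dn b|) d0Ba) => c cBa min_c.
move: (bBa) (cBa); rewrite !inE => /andP[ba bB] /andP[ca cB].
exists (a |: [set b; c]); split.
- by apply/subsetP=> x; rewrite !inE => /or3P[] /eqP ->.
- rewrite cardsU1 cards2 !inE negb_or ![a == _]eq_sym ba ca.
  by case: (b != c).
move=> u uS /subsetP Ku; apply/subsetP=> d dB.
have adj x : x \in a |: [set b; c] -> e x u by move/Ku; rewrite inE sym_e.
have au : e a u by apply: adj; rewrite !inE eqxx.
rewrite inE sym_e; case: (eqVneq d a) => [-> //|da].
have dBa : d \in B :\ a by rewrite !inE da.
have uX x : e x u -> u \in X x by move=> xu; rewrite in_set uS au.
apply: updn.
- apply: (subsetP (up_chain b d _)); first exact: min_b.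
  by apply/(subsetP (Xup b))/uX/adj; rewrite !inE eqxx orbT.
- apply: (subsetP (dn_chain c d _)); first exact: min_c.
  by apply/(subsetP (Xdn c))/uX/adj; rewrite !inE eqxx !orbT.
Qed.

(** * Multiplicities of twin classes and their divisibility *)

Definition twin_sum e S B : nat := \sum_(u | nbhd e u == B) S u.

Lemma common_sumE e S K : symmetric e ->
  common_sum e S K = \sum_(u | K \subset nbhd e u) S u.
Proof.
move=> sym_e; apply: eq_bigl => u; apply/bigcapP/subsetP => h v /h.
  by rewrite !inE sym_e.
by rewrite !inE sym_e.
Qed.

Lemma common_sum_twin e S K : symmetric e ->
  common_sum e S K = \sum_(B : {set T} | K \subset B) twin_sum e S B.
Proof.
move=> sym_e; rewrite common_sumE //.
rewrite (partition_big (nbhd e) (fun B => K \subset B)) //=.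
apply: eq_bigr => B KB; apply: eq_bigl => u.
by case: eqP => [->|_]; rewrite ?KB ?andbF.
Qed.

(** Handles the sets that meet [supp S], about which r-incidence says nothing: a vertex of [supp S]
    has no neighbour of positive multiplicity. *)
Lemma common_sum_supp e S K x : symmetric e -> independent_ms e S ->
  x \in K -> x \in supp S -> common_sum e S K = 0.
Proof.
move=> sym_e indS xK xS; rewrite common_sumE // big1 // => u /subsetP/(_ x xK).
rewrite inE => ux; apply/eqP; rewrite eqn0Ngt.
by apply: contraL ux => uS; apply: indS; rewrite // inE.
Qed.

Lemma common_sum_dvd e S r B : simple_graph e -> circle_graph e ->
  1 <= r -> independent_ms e S -> r_incident e r S -> 1 < #|B| ->
  2 ^ r.-1 %| common_sum e S B.
Proof.
(* For [r = 1] the divisor is 1; from [r = 2] on, r-incidence covers [k = 1] as well as [k = 0]. *)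
case: r => [//|[|r]] se ce _ indS inc cardB; first by rewrite dvd1n.
have [sym_e _] := se.
have [BS|] := boolP (B \subset ~: supp S); last first.
  by case/subsetPn => x xB; rewrite inE negbK => /(common_sum_supp sym_e indS xB) ->; exact: dvdn0.
have [K [KB cardK commK]] := common_nbhd_three se ce indS cardB.
have -> : common_sum e S B = common_sum e S K.
  rewrite !common_sumE // big_mkcond [RHS]big_mkcond; apply: eq_bigr => u _.
  case: ifP => [Bu|nBu]; first by rewrite (subset_trans KB Bu).
  case: ifP => // Ku; apply/esym/eqP; rewrite eqn0Ngt; apply: contraFN nBu => uS.
  by apply: commK; rewrite // inE.
have KS := subset_trans KB BS.
(* Both sizes give the same exponent: [delta 0 = 1] lowers it for [k = 0] just as [k] itself does
   for [k = 1]. *)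
have [K2|K3] : #|K| = 0.+2 \/ #|K| = 1.+2 by lia.
- by have := inc 0 isT K KS K2; rewrite /delta subn0 subn1.
- by have := inc 1 isT K KS K3; rewrite /delta subn0 subn1.
Qed.

(* Moebius inversion over the supersets of [B]. *)
Lemma twin_sum_dvd e S d B : symmetric e ->
  (forall B', 1 < #|B'| -> d %| common_sum e S B') ->
  1 < #|B| -> d %| twin_sum e S B.
Proof.
move=> sym_e dvd_common.
have [n] := ubnP #|~: B|; elim: n B => // n IHn B; rewrite ltnS => le_Bn cardB.
have := dvd_common B cardB; rewrite common_sum_twin // (bigD1 B) //=.
rewrite dvdn_addl // dvdn_sum // => B' /andP[BB' neq].
have prB : B \proper B' by rewrite properEneq eq_sym neq.
apply: IHn; last exact: leq_trans (subset_leq_card BB').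
by apply: leq_trans le_Bn; apply: proper_card; rewrite properC.
Qed.

(** * Parities and representatives of twin classes *)

Lemma modn_pow2_half r n : 0 < r -> 2 ^ r.-1 %| n ->
  (n %% 2 ^ r == 2 ^ r.-1) = odd (n %/ 2 ^ r.-1).
Proof.
case: r => // r _ /= /dvdnP[k ->]; rewrite mulnK ?expn_gt0 // expnS -muln_modl.
by rewrite modn2 -[X in _ == X]mul1n eqn_pmul2r ?expn_gt0 //; case: odd.
Qed.

Lemma odd_sum (I : finType) (P : pred I) (F G : I -> nat) :
  (forall i, P i -> odd (F i) = odd (G i)) ->
  odd (\sum_(i | P i) F i) = odd (\sum_(i | P i) G i).
Proof.
move=> FG; elim/big_rec2: _ => // i m n Pi mn.
by rewrite !oddD mn FG.
Qed.

(* [pick] returns the same vertex for all twins, so it selects one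
   representative of each class of twins meeting [supp S]. *)
Definition odd_twins e r S : {set T} :=
  [set u | ([pick v | (0 < S v) && (nbhd e v == nbhd e u)] == Some u) &&
    (twin_sum e S (nbhd e u) %% 2 ^ r == 2 ^ r.-1)].

Lemma odd_twins_supp e r S : odd_twins e r S \subset supp S.
Proof.
apply/subsetP=> u; rewrite !inE => /andP[+ _].
by case: pickP => // v /andP[vS _] /eqP[<-].
Qed.

Lemma card_odd_twins_class e r S B :
  \sum_(u in odd_twins e r S | nbhd e u == B) 1 =
  (twin_sum e S B %% 2 ^ r == 2 ^ r.-1).
Proof.
case: (eqVneq (twin_sum e S B %% 2 ^ r) (2 ^ r.-1)) => [hB|nB]; last first.
  rewrite big_pred0 // => u; apply: contraNF nB => /andP[].
  by rewrite inE => /andP[_ +] /eqP <-.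
case: (pickP (fun v => (0 < S v) && (nbhd e v == B))) => [u /andP[uS /eqP uB]|noB].
  have [v hv] : exists v, [pick v | (0 < S v) && (nbhd e v == B)] = Some v.
    by case: pickP => [v _|/(_ u)]; [exists v|rewrite uS uB eqxx].
  rewrite (big_pred1 v) // => w /=; rewrite inE andbAC; case: (eqVneq (nbhd e w) B) => [wB|nwB].
    by rewrite wB hv hB eqxx !andbT [RHS]eq_sym (inj_eq (@Some_inj _)).
  rewrite andbF /=; apply/esym; apply: contraNF nwB => /eqP ->.
  by move: hv; case: pickP => // x /andP[_ xB] [<-].
(* A class that misses [supp S] has sum 0, whose residue is not [2 ^ r.-1]. *)
have S0 : twin_sum e S B = 0.
  rewrite /twin_sum big1 // => u uB; apply/eqP; rewrite eqn0Ngt.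
  by have := noB u; rewrite uB andbT => ->.
by move: hB; rewrite S0 mod0n => /eqP; rewrite eq_sym expn_eq0.
Qed.

(** After division by [2 ^ r.-1] both sides are parities of sums over the classes [B] containing [a]
    and [b]; each class contributes one chosen vertex exactly when its quotient is odd. *)
Lemma odd_twins_common e r S a b : simple_graph e -> 0 < r -> a != b ->
  (forall B, 1 < #|B| -> 2 ^ r.-1 %| common_sum e S B) ->
  odd #|[set u in odd_twins e r S | e u a && e u b]| =
  (common_sum e S [set a; b] %% 2 ^ r == 2 ^ r.-1).
Proof.
move=> [sym_e _] r0 neq dvd_common.
have card2 B : [set a; b] \subset B -> 1 < #|B|.
  by move/subset_leq_card; rewrite cards2 neq.
have dvdB B (abB : [set a; b] \subset B) := twin_sum_dvd sym_e dvd_common (card2 B abB).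
rewrite modn_pow2_half // ?dvd_common ?cards2 ?neq // common_sum_twin //.
have -> : (\sum_(B : {set T} | [set a; b] \subset B) twin_sum e S B) %/ 2 ^ r.-1 =
    \sum_(B : {set T} | [set a; b] \subset B) (twin_sum e S B %/ 2 ^ r.-1).
  rewrite -[RHS](mulnK _ (expn_gt0 2 r.-1)) big_distrl /=; congr (_ %/ _).
  by apply: eq_bigr => B abB; rewrite divnK ?dvdB.
rewrite -sum1_card (partition_big (nbhd e) (fun B => [set a; b] \subset B)) /=; last first.
  by move=> u; rewrite inE => /and3P[_ ua ub]; rewrite subUset !sub1set !inE ua.
apply: odd_sum => B abB; rewrite -modn_pow2_half // ?dvdB //.
transitivity (odd (\sum_(u in odd_twins e r S | nbhd e u == B) 1)); last first.
  by rewrite card_odd_twins_class oddb.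
congr (odd _); apply: eq_bigl => u; rewrite [in LHS]inE; case: eqP => [uB|_]; rewrite ?andbF //.
move: abB; rewrite -uB subUset !sub1set !inE => /andP[-> ->].
by rewrite !andbT.
Qed.

End CircleGraphs.

Theorem mainTheorem3 (T : finType) (e : rel T) :
  simple_graph e -> circle_graph e ->
  forall (r : nat) (S : T -> nat),
    1 <= r -> independent_ms e S -> r_incident e r S ->
    exists A : {set T},
      independent_set e A /\
      (forall a b, star_r e r S a b = star_1 e A a b) /\
      circle_graph (star_r e r S).
Proof.
move=> se ce r S r1 indS inc.
have indA : independent_set e (odd_twins e r S).
  by move=> u v /(subsetP (odd_twins_supp e r S)) + /(subsetP (odd_twins_supp e r S)); exact: indS.
have eqA a b : star_r e r S a b = star_1 e (odd_twins e r S) a b.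
  rewrite star_1E // /star_r; case: (eqVneq a b) => //= neq.
  rewrite odd_twins_common // => B; exact: common_sum_dvd.
exists (odd_twins e r S); split=> //; split=> //.
apply: (@eq_circle_graph _ (star_1 e (odd_twins e r S))) => [a b|].
  by rewrite eqA.
exact: foldl_local_comp_circle_graph.
Qed.
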